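(* Let $\mathbf{k}$ be a field of characteristic $0$, let $r\ge 0$ and let $P$ be a reduced $r$-tame operad in cochain complexes of $\mathbf{k}$-vector spaces. Then the minimal model of $P$ is $r$-tame.
   Context: Operads are unital symmetric operads in unbounded cochain complexes of $\mathbf{k}$-vector spaces (differential of degree $+1$). Every operad $P$ considered is connected: $P(1)=\mathbf{k}$ concentrated in degree $0$. $P$ is reduced if $P(0)=0$. $P$ is $r$-tame if for all $n\ge 2$, $P(n)^q=0$ for all $q\le(1-n)(1+r)$. A minimal operad is an operad that is free as a graded operad, $\Gamma(E)$, on a graded $\Sigma$-module $E$ with $E(0)=E(1)=0$, with decomposable differential (the differential sends generators to sums of compositions involving at least two generators). A minimal model of $P$ is a minimal operad $P_\infty$ together with a quasi-isomorphism of operads $P_\infty\to P$ (a morphism inducing an isomorphism in cohomology in every arity). Every reduced operad $P$ with $H(P)(1)=\mathbf{k}$ has a minimal model, unique up to isomorphism. *)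

(* Defs.v *)
From mathcomp Require Import all_boot all_order all_fingroup all_algebra.

Set Implicit Arguments.
Unset Strict Implicit.
Unset Printing Implicit Defensive.

Import Order.TTheory GRing.Theory Num.Theory.

Local Open Scope ring_scope.

(* Operads are presented by partial compositions, symmetric groups acting on  *)
(* the right. Inputs are numbered from 0, and degrees are cohomological. To   *)
(* avoid transports, operations take as arguments the equations relating the  *)
(* arities and degrees of their operands and of their result; such proofs are *)
(* unique because equality on nat and int is decidable.                       *)

Definition zero_space (k : fieldType) (V : lmodType k) : Prop :=
  forall x : V, x = 0.

(* [sact s x] is the right translate x.s: input i of x.s is input s(i) of x.  *)
(* Permutations compose from left to right in [(t * s)%g], so that            *)
(* (x.s).t = x.(s o t) = [sact (t * s)%g x].                                  *)
Record sigmaModule (k : fieldType) := SigmaModule {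
  piece :> nat -> int -> lmodType k;
  sact : forall (n : nat) (p : int), 'S_n -> {linear piece n p -> piece n p};
  sact1 : forall (n : nat) (p : int) (x : piece n p), sact p 1%g x = x;
  sactM : forall (n : nat) (p : int) (s t : 'S_n) (x : piece n p),
    sact p (t * s)%g x = sact p t (sact p s x)
}.

Arguments sact {k s n p} : rename.

(* In x o_i y, with y of arity n, the inputs of y become i, ..., i + n - 1,   *)
(* those of x before i keep their number, and an input j > i of x becomes     *)
(* j + n - 1.                                                                 *)
Definition outer_input (n i j : nat) : nat :=
  if (j < i)%N then j else (j + n).-1.

(* u is the permutation s o_i t: it sends the inputs of (x.s) o_i (y.t) to    *)
(* the matching inputs of x o_(s i) y. These conditions determine u.          *)
Definition perm_graft (m n l : nat) (i : 'I_m) (s : 'S_m) (t : 'S_n)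
    (u : 'S_l) : Prop :=
  (forall (a : 'I_l) (c : 'I_n),
     a = (i + c)%N :> nat -> u a = (s i + t c)%N :> nat) /\
  (forall (a : 'I_l) (j : 'I_m), j != i ->
     a = outer_input n i j :> nat -> u a = outer_input n (s i) (s j) :> nat).

Record gradedOperad (k : fieldType) := GradedOperad {
  operad_module :> sigmaModule k;
  op1 : operad_module 1%N 0;
  pcomp : forall (m n l : nat) (p q d : int),
    (m + n)%N = l.+1 -> p + q = d -> 'I_m ->
    operad_module m p -> operad_module n q -> operad_module l d;
  pcomp_linear_l : forall (m n l : nat) (p q d : int)
    (hl : (m + n)%N = l.+1) (hd : p + q = d)
    (i : 'I_m) (y : operad_module n q), linear (fun x => pcomp hl hd i x y);
  pcomp_linear_r : forall (m n l : nat) (p q d : int)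
    (hl : (m + n)%N = l.+1) (hd : p + q = d)
    (i : 'I_m) (x : operad_module m p), linear (pcomp hl hd i x);
  pcomp1l : forall (n : nat) (q : int) (hl : (1 + n)%N = n.+1) (hd : 0 + q = q)
    (y : operad_module n q), pcomp hl hd ord0 op1 y = y;
  pcomp1r : forall (m : nat) (p : int) (hl : (m + 1)%N = m.+1) (hd : p + 0 = p)
    (i : 'I_m) (x : operad_module m p), pcomp hl hd i x op1 = x;
  (* (x o_i y) o_(i + j) z = x o_i (y o_j z) *)
  pcomp_sequential : forall (l m n a b c : nat) (p q r pq qr d : int)
    (ha : (l + m)%N = a.+1) (hc : (a + n)%N = c.+1)
    (hb : (m + n)%N = b.+1) (hc' : (l + b)%N = c.+1)
    (hpq : p + q = pq) (hd : pq + r = d) (hqr : q + r = qr) (hd' : p + qr = d)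
    (i : 'I_l) (j : 'I_m) (ij : 'I_a)
    (x : operad_module l p) (y : operad_module m q) (z : operad_module n r),
    ij = (i + j)%N :> nat ->
    pcomp hc hd ij (pcomp ha hpq i x y) z =
      pcomp hc' hd' i x (pcomp hb hqr j y z);
  (* for i < j,                                                               *)
  (* (x o_i y) o_(j + m - 1) z = (-1)^(|y| |z|) (x o_j z) o_i y               *)
  pcomp_parallel : forall (l m n a b c : nat) (p q r pq pr d : int)
    (ha : (l + m)%N = a.+1) (hc : (a + n)%N = c.+1)
    (hb : (l + n)%N = b.+1) (hc' : (b + m)%N = c.+1)
    (hpq : p + q = pq) (hd : pq + r = d) (hpr : p + r = pr) (hd' : pr + q = d)
    (i j : 'I_l) (j' : 'I_a) (i' : 'I_b)
    (x : operad_module l p) (y : operad_module m q) (z : operad_module n r),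
    (i < j)%N ->
    j' = outer_input m i j :> nat -> i' = outer_input n j i :> nat ->
    pcomp hc hd j' (pcomp ha hpq i x y) z =
      (-1) ^ (q * r) *: pcomp hc' hd' i' (pcomp hb hpr j x z) y;
  (* (x.s) o_i (y.t) = (x o_(s i) y).(s o_i t) *)
  pcomp_act : forall (m n l : nat) (p q d : int)
    (hl : (m + n)%N = l.+1) (hd : p + q = d)
    (i : 'I_m) (s : 'S_m) (t : 'S_n) (u : 'S_l)
    (x : operad_module m p) (y : operad_module n q),
    perm_graft i s t u ->
    pcomp hl hd i (sact s x) (sact t y) = sact u (pcomp hl hd (s i) x y)
}.

Arguments op1 {k} g.
Arguments pcomp {k g m n l p q d}.

(* Operads in unbounded cochain complexes. *)
Record dgOperad (k : fieldType) := DGOperad {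
  dg_operad :> gradedOperad k;
  diff : forall (n : nat) (p q : int),
    p + 1 = q -> {linear dg_operad n p -> dg_operad n q};
  diffK : forall (n : nat) (p q r : int) (hq : p + 1 = q) (hr : q + 1 = r)
    (x : dg_operad n p),
    diff n hr (diff n hq x) = 0;
  diff_act : forall (n : nat) (p q : int) (hq : p + 1 = q) (s : 'S_n)
    (x : dg_operad n p),
    diff n hq (sact s x) = sact s (diff n hq x);
  diff_op1 : forall (q : int) (hq : 0 + 1 = q), diff 1 hq (op1 dg_operad) = 0;
  (* d (x o_i y) = dx o_i y + (-1)^|x| x o_i dy *)
  diff_comp : forall (m n l : nat) (p q d p' q' d' : int)
    (hl : (m + n)%N = l.+1) (hd : p + q = d)
    (hp' : p + 1 = p') (hq' : q + 1 = q') (hd' : d + 1 = d')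
    (hl' : p' + q = d') (hr' : p + q' = d')
    (i : 'I_m) (x : dg_operad m p) (y : dg_operad n q),
    diff l hd' (pcomp hl hd i x y) =
      pcomp hl hl' i (diff m hp' x) y +
      (-1) ^ p *: pcomp hl hr' i x (diff n hq' y)
}.

Arguments diff {k d n p q} : rename.

Record sigmaHom (k : fieldType) (E F : sigmaModule k) := SigmaHom {
  sigma_fun :> forall (n : nat) (p : int), {linear E n p -> F n p};
  sigma_fun_act : forall (n : nat) (p : int) (s : 'S_n) (x : E n p),
    sigma_fun n p (sact s x) = sact s (sigma_fun n p x)
}.

Arguments sigma_fun {k E F} s {n p} : rename.

Record operadHom (k : fieldType) (P Q : gradedOperad k) := OperadHom {
  operad_fun :> sigmaHom P Q;
  operad_fun1 : operad_fun 1%N 0 (op1 P) = op1 Q;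
  operad_fun_comp : forall (m n l : nat) (p q d : int)
    (hl : (m + n)%N = l.+1) (hd : p + q = d)
    (i : 'I_m) (x : P m p) (y : P n q),
    operad_fun l d (pcomp hl hd i x y) =
      pcomp hl hd i (operad_fun m p x) (operad_fun n q y)
}.

Record dgOperadHom (k : fieldType) (P Q : dgOperad k) := DGOperadHom {
  dg_fun :> operadHom P Q;
  dg_fun_diff : forall (n : nat) (p q : int) (hq : p + 1 = q) (x : P n p),
    dg_fun n q (diff hq x) = diff hq (dg_fun n p x)
}.

Definition connected (k : fieldType) (P : dgOperad k) : Prop :=
  bijective (fun a : k => a *: op1 P) /\
  (forall p : int, p != 0 -> zero_space (P 1%N p)).

Definition reduced (k : fieldType) (P : dgOperad k) : Prop :=
  forall p : int, zero_space (P 0%N p).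

Definition tame (k : fieldType) (r : nat) (P : dgOperad k) : Prop :=
  forall (n : nat) (q : int), (2 <= n)%N ->
    q <= (1 - n%:Z) * (1 + r%:Z) -> zero_space (P n q).

Definition cocycle (k : fieldType) (P : dgOperad k) (n : nat) (p : int)
    (x : P n p) : Prop :=
  forall (q : int) (hq : p + 1 = q), diff hq x = 0.

Definition cohomologous (k : fieldType) (P : dgOperad k) (n : nat) (p : int)
    (x y : P n p) : Prop :=
  exists (q : int) (hp : q + 1 = p) (z : P n q), x - y = diff hp z.

(* The cohomology H^p(P)(n) is the space of cocycles modulo [cohomologous];   *)
(* the induced map, which is linear, is required to be bijective.             *)
Definition quasi_iso (k : fieldType) (P Q : dgOperad k) (f : dgOperadHom P Q) :
    Prop :=
  forall (n : nat) (p : int),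
    (forall x y : P n p, cocycle x -> cocycle y ->
       cohomologous (f n p x) (f n p y) -> cohomologous x y) /\
    (forall y : Q n p, cocycle y ->
       exists2 x : P n p, cocycle x & cohomologous (f n p x) y).

(* iota exhibits M as the free graded operad on E. *)
Definition is_free (k : fieldType) (E : sigmaModule k) (M : gradedOperad k)
    (iota : sigmaHom E M) : Prop :=
  forall (Q : gradedOperad k) (g : sigmaHom E Q),
    (exists f : operadHom M Q,
       forall n p (e : E n p), f n p (iota n p e) = g n p e) /\
    (forall f f' : operadHom M Q,
       (forall n p (e : E n p), f n p (iota n p e) = g n p e) ->
       (forall n p (e : E n p), f' n p (iota n p e) = g n p e) ->
       forall n p (x : M n p), f n p x = f' n p x).

(* [composite iota w x]: x is an operadic composition of w generators.        *)
Inductive composite (k : fieldType) (E : sigmaModule k) (M : gradedOperad k)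
    (iota : sigmaHom E M) : nat -> forall (n : nat) (p : int), M n p -> Prop :=
| composite_op1 : composite iota 0 (op1 M)
| composite_gen n p (e : E n p) : composite iota 1 (iota n p e)
| composite_act w n p (s : 'S_n) (x : M n p) :
    composite iota w x -> composite iota w (sact s x)
| composite_comp v w (m n l : nat) (p q d : int)
    (hl : (m + n)%N = l.+1) (hd : p + q = d)
    (i : 'I_m) (x : M m p) (y : M n q) :
    composite iota v x -> composite iota w y ->
    composite iota (v + w) (pcomp hl hd i x y).

Definition decomposable (k : fieldType) (E : sigmaModule k)
    (M : gradedOperad k) (iota : sigmaHom E M) (n : nat) (p : int) (x : M n p) :
    Prop :=
  exists (N : nat) (a : 'I_N -> k) (y : 'I_N -> M n p),
    (forall i, exists2 w : nat, (2 <= w)%N & composite iota w (y i)) /\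
    x = \sum_(i < N) a i *: y i.

Definition minimal (k : fieldType) (M : dgOperad k) : Prop :=
  exists (E : sigmaModule k) (iota : sigmaHom E M),
    [/\ forall p : int, zero_space (E 0%N p),
        forall p : int, zero_space (E 1%N p),
        is_free iota &
        forall (n : nat) (p q : int) (hq : p + 1 = q) (e : E n p),
          decomposable iota (diff hq (iota n p e))].

Definition minimal_model (k : fieldType) (P M : dgOperad k)
    (f : dgOperadHom M P) : Prop :=
  minimal M /\ quasi_iso f.

(* Main.v *)
Require Import Defs.
From HB Require Import structures.
From mathcomp Require Import all_boot all_order all_fingroup all_algebra.
From mathcomp Require Import boolp zify.

Set Implicit Arguments.
Unset Strict Implicit.
Unset Printing Implicit Defensive.

Import Order.TTheory GRing.Theory Num.Theory.

Local Open Scope ring_scope.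

(** Write M = Gamma(E) for the minimal model. Call a degree low in arity n when
    it is at most (1 - n)(1 + r). The quantity (1 - n)(1 + r) adds up under
    partial composition, just like the degree, because n - 1 does. Since
    generators have arity at least 2, a composite of w generators whose degrees
    are not low therefore has degree at least (1 - n)(1 + r) + w
    ([composite_bound]). In particular tameness of M follows from the vanishing
    in M of all generators of low degree.

    That vanishing is proved by induction on the arity n
    ([minimal_model_tame_generators]). A decomposable of arity n only involves
    generators of arity less than n, so by induction and the estimate above with
    w >= 2, decomposables of arity n vanish up to degree (1 - n)(1 + r) + 1.
    Let e be a generator of low degree. Its differential is decomposable and of
    degree at most (1 - n)(1 + r) + 1, so e is a cocycle. As P vanishes in low
    degrees, the quasi-isomorphism forces e = dz. Now the differential raises
    the number of generators ([weight_ge_diff]) and every element of arity at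
    least 2 is a combination of composites of at least one generator
    ([weight_ge1]), so dz is itself decomposable, and of low degree: e = 0.

    That M is spanned by composites of generators is extracted from the
    universal property: the map from M to the suboperad spanned by composites,
    followed by the inclusion, must be the identity ([free_operad_ind]). *)

(** * Suboperads and generation of free operads *)

(* [pcomp] otherwise denotes the composition of partial functions. *)
Local Notation pcomp := Defs.pcomp.

(** Subspaces of an arbitrary, possibly infinite-dimensional, vector space, with
    undecidable membership. *)
Record subspace (k : fieldType) (V : lmodType k) := Subspace {
  subspace_pred :> V -> Prop;
  subspace0 : subspace_pred 0;
  subspaceP : forall (a : k) (x y : V),
    subspace_pred x -> subspace_pred y -> subspace_pred (a *: x + y)
}.

Definition subspace_preim (k : fieldType) (V W : lmodType k)
  (f : {linear V -> W}) (B : subspace W) : subspace V.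
Proof.
refine (@Subspace k V (fun x => B (f x)) _ _).
- by rewrite linear0; apply: subspace0.
- by move=> a x y hx hy; rewrite linearP; apply: subspaceP.
Defined.

Definition zero_subspace (k : fieldType) (V : lmodType k) : subspace V.
Proof.
refine (@Subspace k V (fun x => x = 0) _ _) => // a x y -> ->.
by rewrite scaler0 addr0.
Defined.

Section SubspaceType.
Variables (k : fieldType) (V : lmodType k) (A : subspace V).

(** Subtypes are cut out by boolean predicates, whence the classical truth value
    of the membership proposition. *)
Definition subspace_mem : {pred V} := fun x => `[< A x >].

Lemma subspace_mem_closed : submod_closed subspace_mem.
Proof.
split; first exact/asboolP/subspace0.
by move=> a x y /asboolP hx /asboolP hy; apply/asboolP/subspaceP.
Qed.

HB.instance Definition _ :=
  GRing.isSubmodClosed.Build k V subspace_mem subspace_mem_closed.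

Definition subspace_type := {x : V | x \in subspace_mem}.

HB.instance Definition _ := SubType.on subspace_type.
HB.instance Definition _ := Choice.on subspace_type.
HB.instance Definition _ := [SubChoice_isSubLmodule of subspace_type by <:].

Definition subspace_elt (x : V) (hx : A x) : subspace_type :=
  exist _ x (introT (asboolP _) hx).

Lemma subspace_val (x : subspace_type) : A (val x).
Proof. by case: x => x hx; apply: asboolW. Qed.

End SubspaceType.

Record suboperad (k : fieldType) (M : gradedOperad k) := Suboperad {
  subop_space :> forall (n : nat) (p : int), subspace (M n p);
  subop_op1 : subop_space 1%N 0 (op1 M);
  subop_act : forall (n : nat) (p : int) (s : 'S_n) (x : M n p),
    subop_space n p x -> subop_space n p (sact s x);
  subop_comp : forall (m n l : nat) (p q d : int)
    (hl : (m + n)%N = l.+1) (hd : p + q = d)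
    (i : 'I_m) (x : M m p) (y : M n q),
    subop_space m p x -> subop_space n q y ->
    subop_space l d (pcomp hl hd i x y)
}.

Section SuboperadOperad.
Variables (k : fieldType) (M : gradedOperad k) (A : suboperad M).

Let T (n : nat) (p : int) : lmodType k := subspace_type (A n p).

Definition subop_sact_fun n p (s : 'S_n) (x : T n p) : T n p :=
  subspace_elt (subop_act s (subspace_val x)).

Lemma subop_sact_linear n p (s : 'S_n) : linear (@subop_sact_fun n p s).
Proof. by move=> a x y; apply: val_inj; rewrite /= linearP. Qed.

HB.instance Definition _ n p s :=
  GRing.isLinear.Build k (T n p) (T n p) _ (@subop_sact_fun n p s)
    (@subop_sact_linear n p s).

Definition subop_sact n p (s : 'S_n) : {linear T n p -> T n p} :=
  @subop_sact_fun n p s.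

Definition subop_pcomp (m n l : nat) (p q d : int) (hl : (m + n)%N = l.+1)
    (hd : p + q = d) (i : 'I_m) (x : T m p) (y : T n q) : T l d :=
  subspace_elt (subop_comp hl hd i (subspace_val x) (subspace_val y)).

Lemma subop_sact1 n p (x : T n p) : subop_sact p 1%g x = x.
Proof. by apply: val_inj; rewrite /= sact1. Qed.

Lemma subop_sactM n p (s t : 'S_n) (x : T n p) :
  subop_sact p (t * s)%g x = subop_sact p t (subop_sact p s x).
Proof. by apply: val_inj; rewrite /= sactM. Qed.

Definition subop_module : sigmaModule k := SigmaModule subop_sact1 subop_sactM.

Definition subop_operad : gradedOperad k.
Proof.
refine (@GradedOperad k subop_module (subspace_elt (subop_op1 A) : T 1 0)
          subop_pcomp _ _ _ _ _ _ _).
- by move=> m n l p q d hl hd i y a x x'; apply: val_inj => /=;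
    rewrite (pcomp_linear_l hl hd i (val y) a).
- by move=> m n l p q d hl hd i x a y y'; apply: val_inj => /=;
    rewrite (pcomp_linear_r hl hd i (val x) a).
- by move=> n q hl hd y; apply: val_inj; rewrite /= pcomp1l.
- by move=> m p hl hd i x; apply: val_inj; rewrite /= pcomp1r.
- move=> l m n a b c p q r pq qr d ha hc hb hc' hpq hd hqr hd' i j ij x y z hij.
  by apply: val_inj; apply: pcomp_sequential.
- move=> l m n a b c p q r pq pr d ha hc hb hc' hpq hd hpr hd' i j j' i' x y z.
  by move=> hij hj hi; apply: val_inj; apply: pcomp_parallel hij hj hi.
- move=> m n l p q d hl hd i s t u x y hu.
  by apply: val_inj; apply: pcomp_act.
Defined.

Definition subop_incl_fun n p (x : subop_operad n p) : M n p :=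
  \val (x : T n p).

Lemma subop_incl_linear n p : linear (@subop_incl_fun n p).
Proof. by []. Qed.

HB.instance Definition _ n p :=
  GRing.isLinear.Build k (subop_operad n p) (M n p) _ (@subop_incl_fun n p)
    (@subop_incl_linear n p).

Definition subop_incl_sigma : sigmaHom subop_operad M.
Proof. by refine (@SigmaHom k subop_operad M (@subop_incl_fun) _). Defined.

Definition subop_incl : operadHom subop_operad M.
Proof. by refine (@OperadHom k subop_operad M subop_incl_sigma _ _). Defined.

End SuboperadOperad.

Section Factor.
Variables (k : fieldType) (E : sigmaModule k) (M : gradedOperad k).
Variables (iota : sigmaHom E M) (A : suboperad M).
Hypothesis hA : forall n p (e : E n p), A n p (iota n p e).

Definition subop_lift_fun n p (e : E n p) : subop_operad A n p :=
  subspace_elt (hA e).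

Lemma subop_lift_linear n p : linear (@subop_lift_fun n p).
Proof. by move=> a x y; apply: val_inj; rewrite /= linearP. Qed.

HB.instance Definition _ n p :=
  GRing.isLinear.Build k (E n p) (subop_operad A n p) _ (@subop_lift_fun n p)
    (@subop_lift_linear n p).

Definition subop_lift : sigmaHom E (subop_operad A).
Proof.
refine (@SigmaHom k E (subop_operad A) (@subop_lift_fun) _).
by move=> n p s x; apply: val_inj => /=; apply: sigma_fun_act.
Defined.

End Factor.

Definition sigma_id_fun (k : fieldType) (M : sigmaModule k) n p :
  {linear M n p -> M n p} := idfun.

Definition operad_id (k : fieldType) (M : gradedOperad k) : operadHom M M.
Proof.
pose idM := @SigmaHom k M M (@sigma_id_fun k M) (fun _ _ _ _ => erefl).
by refine (@OperadHom k M M idM _ _).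
Defined.

Definition operad_comp (k : fieldType) (M N Q : gradedOperad k)
  (g : operadHom N Q) (f : operadHom M N) : operadHom M Q.
Proof.
unshelve refine (@OperadHom k M Q
  (@SigmaHom k M Q (fun n p => g n p \o f n p) _) _ _).
- by move=> n p s x /=; rewrite !sigma_fun_act.
- by rewrite /= !operad_fun1.
- by move=> *; rewrite /= !operad_fun_comp.
Defined.

(** The generators lift to a map g from M to the suboperad A; the composite of g
    with the inclusion of A fixes the generators, so the uniqueness half of the
    universal property identifies it with the identity. *)
Lemma free_operad_ind (k : fieldType) (E : sigmaModule k) (M : gradedOperad k)
    (iota : sigmaHom E M) (A : suboperad M) :
  is_free iota -> (forall n p (e : E n p), A n p (iota n p e)) ->
  forall n p (x : M n p), A n p x.
Proof.
move=> hfree hA n p x.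
have [[g hg] _] := hfree _ (subop_lift hA).
have [_ uniq] := hfree M iota.
rewrite -[x](uniq (operad_comp (subop_incl A) g) (operad_id M)) //=.
  exact: (subspace_val (g n p x : subspace_type _)).
by move=> m q e /=; rewrite hg.
Qed.

(** * The filtration by the number of generators *)

Section WeightFiltration.
Variables (k : fieldType) (E : sigmaModule k) (M : gradedOperad k).
Variable iota : sigmaHom E M.

(** The linear span of the composites of at least c generators. Weight 2 gives
    the decomposables. *)
Inductive weight_ge (c n : nat) (p : int) : M n p -> Prop :=
| weight_ge0 : weight_ge c 0
| weight_geP (a : k) (w : nat) (x y : M n p) :
    (c <= w)%N -> composite iota w x -> weight_ge c y ->
    weight_ge c (a *: x + y).

Lemma weight_ge_linear c n p (a : k) (x y : M n p) :
  weight_ge c x -> weight_ge c y -> weight_ge c (a *: x + y).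
Proof.
move=> hx hy; elim: hx => [|b w {}x x' hw cx _ IH].
  by rewrite scaler0 add0r.
by rewrite scalerDr scalerA -addrA; apply: weight_geP cx IH.
Qed.

Definition weight_space c n p : subspace (M n p) :=
  Subspace (@weight_ge0 c n p) (@weight_ge_linear c n p).

(** A span lies in any subspace that contains its spanning vectors. With B the
    preimage of a subspace under a linear map, this shows that the map respects
    the filtration. *)
Lemma weight_ge_sub c n p (B : subspace (M n p)) (x : M n p) :
  (forall w (y : M n p), (c <= w)%N -> composite iota w y -> B y) ->
  weight_ge c x -> B x.
Proof.
move=> hB; elim=> [|a w y z hw cy _ IH]; first exact: subspace0.
by apply: subspaceP IH; apply: hB cy.
Qed.

Lemma composite_weight_ge c w n p (x : M n p) :
  (c <= w)%N -> composite iota w x -> weight_ge c x.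
Proof.
move=> hw cx; rewrite -[x]addr0 -[x]scale1r.
exact: weight_geP hw cx (@weight_ge0 _ _ _).
Qed.

Lemma weight_ge_mono c c' n p (x : M n p) :
  (c <= c')%N -> weight_ge c' x -> weight_ge c x.
Proof.
move=> hc; apply: (@weight_ge_sub c' _ _ (weight_space c n p)) => w y hw.
by apply: composite_weight_ge; apply: leq_trans hw.
Qed.

(** Partial composition as a linear function of one operand, so that it can be
    used with [subspace_preim] and the lemmas on linear maps. *)
Definition pcompl_fun m n l p q d (hl : (m + n)%N = l.+1) (hd : p + q = d)
  (i : 'I_m) (y : M n q) (x : M m p) : M l d := pcomp hl hd i x y.

HB.instance Definition _ m n l p q d hl hd i y :=
  GRing.isLinear.Build k (M m p) (M l d) _
    (@pcompl_fun m n l p q d hl hd i y) (pcomp_linear_l hl hd i y).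

Definition pcompr_fun m n l p q d (hl : (m + n)%N = l.+1) (hd : p + q = d)
  (i : 'I_m) (x : M m p) (y : M n q) : M l d := pcomp hl hd i x y.

HB.instance Definition _ m n l p q d hl hd i x :=
  GRing.isLinear.Build k (M n q) (M l d) _
    (@pcompr_fun m n l p q d hl hd i x) (pcomp_linear_r hl hd i x).

Lemma weight_ge_act c n p (s : 'S_n) (x : M n p) :
  weight_ge c x -> weight_ge c (sact s x).
Proof.
apply: (@weight_ge_sub c _ _ (subspace_preim (sact s) (weight_space c n p))).
by move=> w y hw cy; apply: composite_weight_ge hw _; apply: composite_act.
Qed.

Lemma weight_ge_comp b c m n l p q d (hl : (m + n)%N = l.+1) (hd : p + q = d)
    (i : 'I_m) (x : M m p) (y : M n q) :
  weight_ge b x -> weight_ge c y -> weight_ge (b + c) (pcomp hl hd i x y).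
Proof.
move=> hx hy; move: hx.
apply: (@weight_ge_sub b _ _
  (subspace_preim (pcompl_fun hl hd i y) (weight_space (b + c) l d))).
move=> v {}x hv cx /=; move: hy.
apply: (@weight_ge_sub c _ _
  (subspace_preim (pcompr_fun hl hd i x) (weight_space (b + c) l d))).
move=> w {}y hw cy /=; apply: (@composite_weight_ge _ (v + w)).
  exact: leq_add.
exact: composite_comp.
Qed.

Lemma decomposable_weight_ge n p (x : M n p) :
  decomposable iota x -> weight_ge 2 x.
Proof.
case=> N [a [y [hy ->]]].
apply: (big_ind (@weight_ge 2 n p)) => [|u v hu hv|i _].
- exact: weight_ge0.
- by rewrite -[u]scale1r; apply: weight_ge_linear.
have [w hw cy] := hy i; rewrite -[_ *: _]addr0.
exact: weight_geP hw cy (@weight_ge0 _ _ _).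
Qed.

Definition generated_suboperad : suboperad M.
Proof.
apply: (@Suboperad k M (weight_space 0)).
- by apply: (@composite_weight_ge 0 0) => //; apply: composite_op1.
- by move=> n p s x; apply: weight_ge_act.
- by move=> m n l p q d hl hd i x y hx hy; apply: (@weight_ge_comp 0 0).
Defined.

Lemma free_generated : is_free iota -> forall n p (x : M n p), weight_ge 0 x.
Proof.
move=> hfree; apply: (free_operad_ind (A := generated_suboperad) hfree).
by move=> n p e; apply: (@composite_weight_ge 0 1) => //; apply: composite_gen.
Qed.

(** * Degree estimates *)

(** The arity is bounded by N to allow an induction. Vanishing is stated in M,
    where the argument on cocycles and coboundaries takes place. *)
Definition tame_generators (r N : nat) : Prop :=
  forall n p (e : E n p), (n < N)%N -> p <= (1 - n%:Z) * (1 + r%:Z) ->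
    iota n p e = 0.

(** Both n - 1 and p - (1 - n)(1 + r) are additive under partial composition,
    and both are at least 1 on a nonzero generator (for the second, one of arity
    less than N). The condition n + 1 < N + w ensures that all generators
    involved have arity less than N: when one of them has arity a, the other
    w - 1 contribute at least w - 1 to n - 1, so a <= n - w + 1 < N. *)
Lemma composite_bound r N w n p (x : M n p) :
  (forall p, zero_space (E 0%N p)) -> (forall p, zero_space (E 1%N p)) ->
  tame_generators r N -> composite iota w x ->
  x = 0 \/ [/\ (w < n)%N, w = 0%N -> n = 1%N &
    (n.+1 < N + w)%N -> (1 - n%:Z) * (1 + r%:Z) + w%:Z <= p].
Proof.
move=> E0 E1 hN; elim=> {w n p x}
  [|n p e|w n p s x _ [->|?]|v w m n l p q d hl hd i x y _ IHx _ IHy].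
- by right; split=> //; lia.
- case: n e => [|[|n]] e; first by left; rewrite (E0 _ e) linear0.
    by left; rewrite (E1 _ e) linear0.
  have [hp|hp] := leP p ((1 - n.+2%:Z) * (1 + r%:Z)); last first.
    by right; split=> //; lia.
  have [hn|hn] := ltnP n.+2 N; first by left; apply: hN.
  by right; split=> //; lia.
- by left; rewrite linear0.
- by right.
case: IHx => [->|[vm v0 hx]].
  by left; apply: (linear0 (pcompl_fun hl hd i y)).
case: IHy => [->|[wn w0 hy]].
  by left; apply: (linear0 (pcompr_fun hl hd i x)).
right; split; [by lia|by lia|move=> hNl].
have {}hx := hx ltac:(lia); have {}hy := hy ltac:(lia).
have -> : l%:Z = m%:Z + n%:Z - 1 by lia.
by rewrite PoszD -hd; nia.
Qed.

Section TameGenerators.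
Variables r N : nat.
Hypotheses (E0 : forall p, zero_space (E 0%N p)).
Hypotheses (E1 : forall p, zero_space (E 1%N p)).
Hypothesis hN : tame_generators r N.

(** For c = 2 and n = N: decomposables of arity N vanish up to degree
    (1 - N)(1 + r) + 1, one degree more than the generators are shown to. *)
Lemma weight_ge_eq0 c n p (x : M n p) :
  (n.+1 < N + c)%N -> p < (1 - n%:Z) * (1 + r%:Z) + c%:Z -> weight_ge c x ->
  x = 0.
Proof.
move=> hn hp; apply: (@weight_ge_sub c n p (zero_subspace _)) => w y hw cy /=.
have [//|[_ _ h]] := composite_bound E0 E1 hN cy.
by have := h ltac:(lia); lia.
Qed.

(** Composites of no generator are multiples of the unit, which has arity 1. *)
Lemma weight_ge1 n p (x : M n p) : (2 <= n)%N -> weight_ge 0 x -> weight_ge 1 x.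
Proof.
move=> hn; apply: (@weight_ge_sub 0 n p (weight_space 1 n p)) => w y _ cy /=.
have [->|[_ h _]] := composite_bound E0 E1 hN cy; first exact: weight_ge0.
by apply: composite_weight_ge cy; case: w h; lia.
Qed.

End TameGenerators.

End WeightFiltration.

(** * The differential and the minimal model *)

Section Differential.
Variables (k : fieldType) (E : sigmaModule k) (M : dgOperad k).
Variable iota : sigmaHom E M.
Hypothesis ddec : forall (n : nat) (p q : int) (hq : p + 1 = q) (e : E n p),
  decomposable iota (diff hq (iota n p e)).

(** By the Leibniz rule, each term of the differential of a composite replaces
    one generator by its differential, which has weight at least 2. *)
Lemma composite_diff w n p q (hq : p + 1 = q) (x : M n p) :
  composite iota w x -> weight_ge iota w.+1 (diff hq x).
Proof.
move=> cx; elim: cx q hq => {w n p x}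
  [|n p e|w n p s x _ IH|v w m n l p q d hl hd i x y cx IHx cy IHy] p' hp'.
- by rewrite diff_op1; apply: weight_ge0.
- exact/decomposable_weight_ge/ddec.
- by rewrite diff_act; apply: weight_ge_act.
have hl' : p + 1 + q = p' by rewrite -hp' -hd addrAC.
have hr' : p + (q + 1) = p' by rewrite -hp' -hd addrA.
rewrite (diff_comp hl hd (erefl _) (erefl _) hp' hl' hr') addrC.
apply: weight_ge_linear.
- rewrite -addnS; apply: weight_ge_comp (IHy _ _).
  exact: composite_weight_ge cx.
- rewrite -addSn; apply: weight_ge_comp (IHx _ _) _.
  exact: composite_weight_ge cy.
Qed.

Lemma weight_ge_diff c n p q (hq : p + 1 = q) (x : M n p) :
  weight_ge iota c x -> weight_ge iota c.+1 (diff hq x).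
Proof.
apply: (@weight_ge_sub _ _ _ _ c _ _
  (subspace_preim (diff hq) (weight_space iota c.+1 n q))).
move=> w y hw cy /=; apply: weight_ge_mono (composite_diff hq cy).
by rewrite ltnS.
Qed.

End Differential.

(** Induction on the arity: in arity N and low degree a generator is a cocycle,
    hence a coboundary, hence a decomposable, and these vanish there. *)
Lemma minimal_model_tame_generators (k : fieldType) (E : sigmaModule k)
    (r : nat) (P M : dgOperad k) (f : dgOperadHom M P) (iota : sigmaHom E M) :
  tame r P -> quasi_iso f ->
  (forall p, zero_space (E 0%N p)) -> (forall p, zero_space (E 1%N p)) ->
  is_free iota ->
  (forall (n : nat) (p q : int) (hq : p + 1 = q) (e : E n p),
    decomposable iota (diff hq (iota n p e))) ->
  forall N, tame_generators iota r N.
Proof.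
move=> htame hqi E0 E1 hfree ddec; elim=> [//|N IH] n p e hnN; move: hnN e.
rewrite ltnS leq_eqVlt => /predU1P[->{n}|hnN] e; last exact: IH.
case: N IH e => [|[|N]] IH e hp; first by rewrite (E0 _ e) linear0.
  by rewrite (E1 _ e) linear0.
set n := N.+2 in IH e hp *.
have hn : (n.+1 < n + 2)%N by lia.
have cocycle_e : cocycle (iota n p e).
  move=> q hq; apply: (weight_ge_eq0 E0 E1 IH hn); first by lia.
  exact: decomposable_weight_ge.
have cocycle_0 : cocycle (0 : M n p) by move=> q hq; rewrite linear0.
(* P vanishes in this degree, so e and 0 have the same image in H(P). *)
have [|q [hq [z]]] := (hqi n p).1 _ _ cocycle_e cocycle_0.
  exists (p - 1), (subrK _ _), 0.
  by rewrite !linear0 addr0; apply: (htame n p).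
rewrite subr0 => ez; apply: (weight_ge_eq0 E0 E1 IH hn); first by lia.
rewrite ez; apply: (weight_ge_diff ddec).
by apply: (weight_ge1 E0 E1 IH) => //; apply: free_generated.
Qed.

Theorem proposition4p10 (k : fieldType) (hk : [pchar k] =i pred0) (r : nat)
    (P : dgOperad k) (hconn : connected P) (hred : reduced P)
    (htame : tame r P) (M : dgOperad k) (f : dgOperadHom M P)
    (hmin : minimal_model f) :
  tame r M.
Proof.
case: hmin => -[E [iota [E0 E1 hfree ddec]]] hqi n p hn hp x.
have hN : tame_generators iota r n.+1.
  exact: minimal_model_tame_generators htame hqi E0 E1 hfree ddec _.
(* With N = n + 1 every generator involved in arity n is covered by hN. *)
apply: (weight_ge_eq0 E0 E1 hN (c := 1)); [by lia|by lia|].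
by apply: (weight_ge1 E0 E1 hN) => //; apply: free_generated.
Qed.
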